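(* Let $(\Gamma_1(t),\Gamma_2(t),\Gamma_3(t))_{t\in[0,T)}$, $T>0$, be a sufficiently smooth solution of the coupled evolution problem described in the context. Then the total volume $\mathbb V(t)$ enclosed by the two grains is time independent.
   Context: **Parameters.** $\mathcal A,\mathcal B>0$, $\beta\in[\pi/2,\pi)$ and $\theta_c\in[0,\pi]$ are constants. **Evolution problem.** For $t\in[0,T)$, $\Gamma_i(t)=\{(r_i(\alpha,t),z_i(\alpha,t)):\alpha\in[0,1]\}$, $i=1,2,3$, where $r_i,z_i$ are sufficiently smooth on $[0,1]\times[0,T)$ ($C^\infty$ may be assumed), $r_{i\alpha}^2+z_{i\alpha}^2>0$, and $r_{i\alpha}r_{i\alpha\alpha}+z_{i\alpha}z_{i\alpha\alpha}=0$. Let $H_i=\frac{r_{i\alpha}z_{i\alpha\alpha}-z_{i\alpha}r_{i\alpha\alpha}}{2(r_{i\alpha}^2+z_{i\alpha}^2)^{3/2}}+\frac{z_{i\alpha}}{2r_i\sqrt{r_{i\alpha}^2+z_{i\alpha}^2}}$, $\hat\tau_i=(r_{i\alpha},z_{i\alpha})/\sqrt{r_{i\alpha}^2+z_{i\alpha}^2}$, and let $\theta_i$ be continuous with values in $(-\pi,\pi]$ and $\hat\tau_i=(\cos\theta_i,\sin\theta_i)$. Equations of motion for $\alpha\in(0,1)$, $t\in(0,T)$: $r_{i\alpha}z_{it}-z_{i\alpha}r_{it}=\frac{-\mathcal B(r_iH_{i\alpha})_\alpha}{r_i\sqrt{r_{i\alpha}^2+z_{i\alpha}^2}}$ for $i=1,2$,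 and $r_{3\alpha}z_{3t}-z_{3\alpha}r_{3t}=\mathcal A\sqrt{r_{3\alpha}^2+z_{3\alpha}^2}\,H_3$. Boundary conditions for $t\in[0,T)$: $(r_1,z_1)(0,t)=(r_1^*(t),0)$, $(r_1,z_1)(1,t)=(r_2,z_2)(0,t)=(r_3,z_3)(1,t)=(\bar r(t),\bar z(t))$, $(r_2,z_2)(1,t)=(1,z_2^*(t))$, $(r_3,z_3)(0,t)=(r_3^*(t),0)$, with $0<r_1^*<r_3^*<1$, $z_2^*>0$, $0<\bar r<1$, $\bar z>0$; $\theta_1(0,t)=\theta_c$, $\theta_2(1,t)=0$, $\theta_3(0,t)=\pi/2$, $-\theta_1(1,t)+\theta_3(1,t)=\beta$, $\theta_2(0,t)-\theta_3(1,t)=-\pi+\beta$; $H_1(1,t)=H_2(0,t)$; $H_{1\alpha}(0,t)=0$, $H_{2\alpha}(1,t)=0$, and $\frac{H_{1\alpha}}{\sqrt{r_{1\alpha}^2+z_{1\alpha}^2}}\Big|_{(1,t)}=\frac{H_{2\alpha}}{\sqrt{r_{2\alpha}^2+z_{2\alpha}^2}}\Big|_{(0,t)}$. Constraints: $0<r_1,r_3<1$ on $[0,1]$, $0<r_2<1$ on $[0,1)$, $z_1,z_3>0$ on $(0,1]$, $z_2>0$ on $[0,1]$ (for all $t$); the curves do not self-intersect, and distinct curves meet only at $(\bar r,\bar z)$. **Volume.** The total volume enclosed by the two grains is expressed as $\mathbb V(t)=2\pi\sum_{i=1,2}\int_0^1z_i\,r_i\,r_{i\alpha}\,d\alpha$.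 *)

(* Defs.v *)
From HB Require Import structures.
From mathcomp Require Import all_boot all_order all_algebra.
From mathcomp Require Import all_classical all_reals all_analysis.

Set Implicit Arguments.
Unset Strict Implicit.
Unset Printing Implicit Defensive.

Import Order.TTheory GRing.Theory Num.Theory.
Import numFieldNormedType.Exports.

Local Open Scope classical_set_scope.
Local Open Scope ring_scope.

(* Derivatives relative to a set: two-sided at interior points of an interval,
   one-sided at an endpoint belonging to it.  Values of f outside A are
   irrelevant, and derive_within is a junk value when the limit fails to exist. *)
Definition derivable_within (R : realType) (A : set R) (f : R -> R) (x : R) :
  Prop := cvg ((f y - f x) / (y - x) @[y --> within A x^']).

Definition derive_within (R : realType) (A : set R) (f : R -> R) (x : R) : R :=
  lim ((f y - f x) / (y - x) @[y --> within A x^']).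

(* Functions of (alpha, t) are curried, alpha first. *)
Definition space_time (R : realType) (T : R) : set (R * R) :=
  [set p | p.1 \in `[0, 1] /\ p.2 \in `[0, T[].

Definition d_alpha (R : realType) (f : R -> R -> R) (a t : R) : R :=
  derive_within [set` `[0, 1]] (f ^~ t) a.

Definition d_t (R : realType) (T : R) (f : R -> R -> R) (a t : R) : R :=
  derive_within [set` `[0, T[] (f a) t.

Definition continuous_st (R : realType) (T : R) (f : R -> R -> R) : Prop :=
  {within space_time T, continuous (fun p : R * R => f p.1 p.2)}.

(* C^k up to the boundary on [0, 1] x [0, T[: all iterated partial derivatives
   of order at most k exist and are jointly continuous there. *)
Fixpoint Ck_st (R : realType) (T : R) (k : nat) (f : R -> R -> R) : Prop :=
  continuous_st T f /\
  if k is k'.+1 then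
    [/\ forall a t : R, space_time T (a, t) ->
          derivable_within [set` `[0, 1]] (f ^~ t) a,
        forall a t : R, space_time T (a, t) ->
          derivable_within [set` `[0, T[] (f a) t,
        Ck_st T k' (d_alpha f)
      & Ck_st T k' (d_t T f)]
  else True.

Definition smooth_st (R : realType) (T : R) (f : R -> R -> R) : Prop :=
  forall k, Ck_st T k f.

(* G1 and G2 are the exterior surfaces of the two grains, G3 the grain
   boundary. *)
Inductive curve : Set := G1 | G2 | G3.

Section geometry.
Variables (R : realType) (r z : R -> R -> R).

Definition speed2 (a t : R) : R := d_alpha r a t ^+ 2 + d_alpha z a t ^+ 2.

Definition speed (a t : R) : R := Num.sqrt (speed2 a t).

Definition mean_curvature (a t : R) : R :=
  (d_alpha r a t * d_alpha (d_alpha z) a t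
     - d_alpha z a t * d_alpha (d_alpha r) a t)
    / (2 * speed2 a t `^ (3 / 2))
  + d_alpha z a t / (2 * r a t * speed a t).

(* The normal velocity is normal_motion / speed. *)
Definition normal_motion (T a t : R) : R :=
  d_alpha r a t * d_t T z a t - d_alpha z a t * d_t T r a t.

Definition surface_diffusion (B T a t : R) : Prop :=
  normal_motion T a t =
    (- B * d_alpha (fun a' t' => r a' t' * d_alpha mean_curvature a' t') a t)
      / (r a t * speed a t).

Definition curvature_motion (A T a t : R) : Prop :=
  normal_motion T a t = A * speed a t * mean_curvature a t.

Definition trace (t : R) : set (R * R) :=
  [set (r a t, z a t) | a in [set` `[0, 1]]].

End geometry.

Record evolution_solution (R : realType) (A B beta theta_c T : R)
    (r z theta : curve -> R -> R -> R)
    (r1s r3s z2s rbar zbar : R -> R) : Prop := EvolutionSolution {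
  sol_smooth : forall i, smooth_st T (r i) /\ smooth_st T (z i) ;
  sol_regular : forall i (a t : R), space_time T (a, t) ->
    0 < d_alpha (r i) a t ^+ 2 + d_alpha (z i) a t ^+ 2 ;
  sol_parametrization : forall i (a t : R), space_time T (a, t) ->
    d_alpha (r i) a t * d_alpha (d_alpha (r i)) a t
    + d_alpha (z i) a t * d_alpha (d_alpha (z i)) a t = 0 ;

  sol_theta_continuous : forall i, continuous_st T (theta i) ;
  sol_theta_range : forall i (a t : R), space_time T (a, t) ->
    - pi < theta i a t <= pi ;
  sol_theta_tangent : forall i (a t : R), space_time T (a, t) ->
    d_alpha (r i) a t / speed (r i) (z i) a t = cos (theta i a t) /\
    d_alpha (z i) a t / speed (r i) (z i) a t = sin (theta i a t) ;

  sol_motion1 : forall a t : R, 0 < a < 1 -> 0 < t < T ->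
    surface_diffusion (r G1) (z G1) B T a t ;
  sol_motion2 : forall a t : R, 0 < a < 1 -> 0 < t < T ->
    surface_diffusion (r G2) (z G2) B T a t ;
  sol_motion3 : forall a t : R, 0 < a < 1 -> 0 < t < T ->
    curvature_motion (r G3) (z G3) A T a t ;

  sol_end1_0 : forall t : R, 0 <= t < T -> r G1 0 t = r1s t /\ z G1 0 t = 0 ;
  sol_end1_1 : forall t : R, 0 <= t < T -> r G1 1 t = rbar t /\ z G1 1 t = zbar t ;
  sol_end2_0 : forall t : R, 0 <= t < T -> r G2 0 t = rbar t /\ z G2 0 t = zbar t ;
  sol_end3_1 : forall t : R, 0 <= t < T -> r G3 1 t = rbar t /\ z G3 1 t = zbar t ;
  sol_end2_1 : forall t : R, 0 <= t < T -> r G2 1 t = 1 /\ z G2 1 t = z2s t ;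
  sol_end3_0 : forall t : R, 0 <= t < T -> r G3 0 t = r3s t /\ z G3 0 t = 0 ;
  sol_r1s_r3s : forall t : R, 0 <= t < T ->
    [/\ 0 < r1s t, r1s t < r3s t & r3s t < 1] ;
  sol_z2s : forall t : R, 0 <= t < T -> 0 < z2s t ;
  sol_rbar : forall t : R, 0 <= t < T -> 0 < rbar t < 1 ;
  sol_zbar : forall t : R, 0 <= t < T -> 0 < zbar t ;

  sol_angle1_0 : forall t : R, 0 <= t < T -> theta G1 0 t = theta_c ;
  sol_angle2_1 : forall t : R, 0 <= t < T -> theta G2 1 t = 0 ;
  sol_angle3_0 : forall t : R, 0 <= t < T -> theta G3 0 t = pi / 2 ;
  sol_angle13 : forall t : R, 0 <= t < T -> - theta G1 1 t + theta G3 1 t = beta ;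
  sol_angle23 : forall t : R, 0 <= t < T ->
    theta G2 0 t - theta G3 1 t = - pi + beta ;

  sol_potential : forall t : R, 0 <= t < T ->
    mean_curvature (r G1) (z G1) 1 t = mean_curvature (r G2) (z G2) 0 t ;
  sol_flux1_0 : forall t : R, 0 <= t < T ->
    d_alpha (mean_curvature (r G1) (z G1)) 0 t = 0 ;
  sol_flux2_1 : forall t : R, 0 <= t < T ->
    d_alpha (mean_curvature (r G2) (z G2)) 1 t = 0 ;
  sol_flux12 : forall t : R, 0 <= t < T ->
    d_alpha (mean_curvature (r G1) (z G1)) 1 t / speed (r G1) (z G1) 1 t =
    d_alpha (mean_curvature (r G2) (z G2)) 0 t / speed (r G2) (z G2) 0 t ;

  sol_r13 : forall a t : R, 0 <= a <= 1 -> 0 <= t < T ->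
    0 < r G1 a t < 1 /\ 0 < r G3 a t < 1 ;
  sol_r2 : forall a t : R, 0 <= a < 1 -> 0 <= t < T -> 0 < r G2 a t < 1 ;
  sol_z13 : forall a t : R, 0 < a <= 1 -> 0 <= t < T ->
    0 < z G1 a t /\ 0 < z G3 a t ;
  sol_z2 : forall a t : R, 0 <= a <= 1 -> 0 <= t < T -> 0 < z G2 a t ;
  sol_simple : forall i (t : R), 0 <= t < T ->
    {in `[0, 1] &, injective (fun a => (r i a t, z i a t))} ;
  sol_disjoint : forall i j (t : R), i <> j -> 0 <= t < T ->
    trace (r i) (z i) t `&` trace (r j) (z j) t `<=` [set (rbar t, zbar t)]
}.

Definition total_volume (R : realType) (r z : curve -> R -> R -> R) (t : R) :
  R :=
  2 * pi * \sum_(i <- [:: G1; G2])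
    \int[lebesgue_measure]_(a in [set` `[0, 1]])
      (z i a t * r i a t * d_alpha (r i) a t).

(* Main.v *)
Require Import Defs.
From HB Require Import structures.
From mathcomp Require Import all_boot all_order all_algebra.
From mathcomp Require Import all_classical all_reals all_analysis.
From mathcomp Require Import ring lra.
Import Order.TTheory GRing.Theory Num.Theory.
Import numFieldNormedType.Exports.
Local Open Scope classical_set_scope.
Local Open Scope ring_scope.

(** Why the volume is conserved.  Write subscripts a, t for derivatives, H for
    the mean curvature and s for the speed of one exterior surface (r, z).
    Differentiating the volume under the integral sign and exchanging r_at and
    r_ta gives, for 0 < t < T, the pointwise identity
      (z r r_a)_t = (z r r_t)_a + r (r_a z_t - z_a r_t).
    The last term is r times the quantity prescribed by surface diffusion, that
    is - B (r H_a)_a / s.  The condition r_a r_aa + z_a z_aa = 0 says that s does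
    not depend on a, so this term is a derivative in a as well, and the rate of
    change of the volume of a grain is the difference between the two endpoints
    of the flux  z r r_t - B r H_a / s  ([volume_density_t_integral]).

    In the sum over the two grains the endpoint terms cancel: at the foot of the
    first surface z = 0 and H_a = 0; at the wall r = 1 is fixed, so r_t = 0, and
    H_a = 0; at the triple junction the two surfaces share r, z, hence r_t, and
    their H_a / s agree.  So the volume has derivative 0 on ]0, T[, and since it
    is continuous up to t = 0 it is constant.

    The data are smooth only up to the boundary of [0, 1] x [0, T[, and the
    derivatives at the boundary are one-sided.  Hence a calculus of derivatives
    relative to a set comes first; it shows in particular that H_a, a derivative
    of a quotient of smooth functions, is continuous up to both endpoints. *)

Set Implicit Arguments.
Unset Strict Implicit.

(** * Derivatives relative to a set *)

Section within_derivative.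
Context {R : realType}.
Implicit Types (A : set R) (f g : R -> R) (x l m : R).

Definition is_derive_within A f x l : Prop :=
  (f y - f x) / (y - x) @[y --> within A x^'] --> l.

Lemma derive_withinP A f x :
  derivable_within A f x -> is_derive_within A f x (derive_within A f x).
Proof. by []. Qed.

(** Makes limits along [within A x^'] unique, so that the total operator
    [derive_within] can be computed from any convergence of difference quotients. *)
Lemma within_dnbhs_proper A x y : is_interval A -> A x -> A y -> x != y ->
  ProperFilter (within A x^').
Proof.
move=> itvA Ax Ay xy; split; last exact: within_filter.
rewrite /within /= => -[e /= e0 He].
have d0 : 0 < `|y - x| by rewrite normr_gt0 subr_eq0 eq_sym.
(* A point x + k (y - x) of the segment from x to y, closer to x than e. *)
pose k := Num.min 1 (e / 2 / `|y - x|).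
have k0 : 0 < k by rewrite lt_min ltr01 !divr_gt0.
have k1 : k <= 1 by rewrite ge_min lexx.
have kd : k * `|y - x| < e.
  have : k <= e / 2 / `|y - x| by rewrite ge_min lexx orbT.
  rewrite ler_pdivlMr// => h.
  apply: (le_lt_trans h); rewrite gtr_pMr// invf_lt1// ltr1n //.
apply: (He (x + k * (y - x))) => /=.
- rewrite opprD addNKr normrN normrM (gtr0_norm k0)//.
- by rewrite -subr_eq0 addrC addKr mulf_neq0 ?(gt_eqF k0)// subr_eq0 eq_sym.
- case: (ltgtP x y) xy => // xy _.
  + apply: (itvA x y) => //; apply/andP; split; nra.
  + apply: (itvA y x) => //; apply/andP; split; nra.
Qed.

Lemma is_derive_within_continuous A f x l : is_derive_within A f x l ->
  f y @[y --> within A x^'] --> f x.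
Proof.
move=> fl.
have yx : (y - x) @[y --> within A x^'] --> 0.
  rewrite -(subrr x); apply: cvgB; last exact: cvg_cst.
  apply: cvg_within_filter; apply: cvg_trans; last exact: cvg_id.
  exact: nbhs_dnbhs.
have -> : f x = l * 0 + f x by rewrite mulr0 add0r.
have : (f y - f x) / (y - x) * (y - x) + f x
    @[y --> within A x^'] --> l * 0 + f x.
  by apply: cvgD; [exact: cvgM|exact: cvg_cst].
apply: cvg_trans; apply: near_eq_cvg.
rewrite near_withinE; near=> y => _.
rewrite divfK ?subrK// subr_eq0.
near: y; exact: nbhs_dnbhs_neq.
Unshelve. all: by end_near. Qed.

Lemma is_derive_within_interior A f x l : nbhs x A -> is_derive_within A f x l ->
  is_derive x 1 f l.
Proof.
move=> xA fl.
suff h : (fun h => h^-1 *: (f (h *: 1 + x) - f x)) @ 0^' --> l.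
  by apply: DeriveDef; [apply/cvg_ex; exists l|exact: cvg_lim].
apply/cvgrPdist_lt => e e0.
move/cvgrPdist_lt: fl => /(_ _ e0); rewrite near_withinE => -[d1 /= d10 H1].
case: xA => d2 /= d20 H2.
exists (Num.min d1 d2); first by rewrite /= lt_min d10.
move=> h /=; rewrite sub0r normrN lt_min => /andP[h1 h2] h0.
rewrite [h *: 1]mulr1.
have := H1 (h + x); rewrite /= opprD addrCA subrr addr0 normrN addrK => /(_ h1).
rewrite mulrC; apply.
- by rewrite -subr_eq0 addrK.
- by apply: H2; rewrite /= opprD addrCA subrr addr0 normrN.
Qed.

Lemma eq_is_derive_within A f g x l : A x -> {in A, f =1 g} ->
  is_derive_within A f x l -> is_derive_within A g x l.
Proof.
move=> Ax fg; apply: cvg_trans; apply: near_eq_cvg.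
rewrite near_withinE; near=> y => Ay.
by rewrite !fg ?inE.
Unshelve. all: by end_near. Qed.

Lemma is_derive_within_cst A c x : is_derive_within A (fun=> c) x 0.
Proof.
rewrite /is_derive_within subrr.
under eq_fun do rewrite mul0r.
exact: cvg_cst.
Qed.

Lemma is_derive_withinD A f g x l m :
  is_derive_within A f x l -> is_derive_within A g x m ->
  is_derive_within A (fun y => f y + g y) x (l + m).
Proof.
move=> fl gm; rewrite /is_derive_within.
under eq_fun do rewrite opprD addrACA mulrDl.
exact: cvgD.
Qed.

Lemma is_derive_withinM A f g x l m :
  is_derive_within A f x l -> is_derive_within A g x m ->
  is_derive_within A (fun y => f y * g y) x (l * g x + f x * m).
Proof.
move=> fl gm; rewrite /is_derive_within.
have -> : (fun y => (f y * g y - f x * g x) / (y - x)) =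
  (fun y => (f y - f x) / (y - x) * g y + f x * ((g y - g x) / (y - x))).
  apply/funext => y; rewrite mulrA [_ / _ * g y]mulrAC -mulrDl.
  by congr (_ / _); ring.
apply: cvgD; apply: cvgM => //; last exact: cvg_cst.
exact: is_derive_within_continuous gm.
Qed.

Lemma is_derive_withinV A f x l : f x != 0 -> is_derive_within A f x l ->
  is_derive_within A (fun y => (f y)^-1) x (- l / f x ^+ 2).
Proof.
move=> fx0 fl; rewrite /is_derive_within.
have cf := is_derive_within_continuous fl.
have fy0 : \forall y \near within A x^', f y != 0.
  exact: (cvgr_neq0 _ cf fx0).
have : - ((f y - f x) / (y - x)) * ((f y)^-1 * (f x)^-1)
    @[y --> within A x^'] --> - l * ((f x)^-1 * (f x)^-1).
  apply: cvgM; first exact: cvgN.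
  by apply: cvgM; [exact: cvgV|exact: cvg_cst].
rewrite -invfM -expr2; apply: cvg_trans; apply: near_eq_cvg.
near=> y.
have fy : f y != 0 by near: y.
rewrite -mulNr mulrAC; congr (_ / _); field.
by rewrite fx0.
Unshelve. all: by end_near. Qed.

End within_derivative.

Section Ck_within.
Context {R : realType}.
Variable A : set R.
Hypothesis limA : forall x, A x -> ProperFilter (within A x^').
Implicit Types (f g : R -> R) (k : nat).

(** Regularity up to the boundary in one variable: [Ck_st] restricts to it on
    each line of constant time, and its stability under products and inverses
    passes the regularity of r and z on to the mean curvature. *)
Fixpoint Ck_within k f : Prop :=
  {within A, continuous f} /\
  if k is k'.+1 then
    (forall x, A x -> derivable_within A f x) /\ Ck_within k' (derive_within A f)
  else True.

Lemma is_derive_withinE f x l : A x -> is_derive_within A f x l ->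
  derive_within A f x = l.
Proof. by move=> Ax fl; have ? := limA Ax; apply: cvg_lim. Qed.

Lemma Ck_within_continuous k f : Ck_within k f -> {within A, continuous f}.
Proof. by case: k => [|k] []. Qed.

Lemma Ck_withinS k f : Ck_within k.+1 f -> Ck_within k f.
Proof.
elim: k f => [|k IH] f [cf [df dkf]]; split => //.
by split => //; exact: IH.
Qed.

Lemma Ck_within_is_derive k f x : Ck_within k.+1 f -> A x ->
  is_derive_within A f x (derive_within A f x).
Proof. by move=> [_ [df _]] Ax; exact: df. Qed.

(** Closure properties compute a derivative f' only on A, whereas
    [derive_within A f] is arbitrary elsewhere; hence the quantification over all
    g that agree with f' on A. *)
Lemma Ck_withinI k f f' : {within A, continuous f} ->
  (forall x, A x -> is_derive_within A f x (f' x)) ->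
  (forall g, {in A, f' =1 g} -> Ck_within k g) -> Ck_within k.+1 f.
Proof.
move=> cf df f'k; split => //; split.
  by move=> x Ax; apply/cvg_ex; exists (f' x); exact: df.
by apply: f'k => x /set_mem Ax; rewrite (is_derive_withinE Ax (df _ Ax)).
Qed.

Lemma eq_within_continuous f g : {in A, f =1 g} ->
  {within A, continuous f} -> {within A, continuous g}.
Proof. by move=> fg; exact: subspace_eq_continuous. Qed.

Lemma eq_Ck_within k f g : {in A, f =1 g} -> Ck_within k f -> Ck_within k g.
Proof.
elim: k f g => [|k IH] f g fg kf.
  by split=> //; apply: eq_within_continuous fg _; case: kf.
apply: (@Ck_withinI k g (derive_within A f)).
- by apply: eq_within_continuous fg _; case: kf.
- move=> x Ax; apply: eq_is_derive_within fg _ => //.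
  exact: Ck_within_is_derive kf _.
- by move=> h fh; apply: IH fh _; case: kf => _ [].
Qed.

Lemma Ck_within_cst k c : Ck_within k (fun=> c).
Proof.
elim: k c => [|k IH] c; first by split=> // x; exact: cvg_cst.
apply: (@Ck_withinI k _ (fun=> 0)).
- by move=> x; exact: cvg_cst.
- by move=> x _; exact: is_derive_within_cst.
- by move=> g eg; apply: eq_Ck_within eg (IH 0).
Qed.

Lemma Ck_withinD k f g : Ck_within k f -> Ck_within k g ->
  Ck_within k (fun x => f x + g x).
Proof.
elim: k f g => [|k IH] f g kf kg.
  split=> //; case: kf kg => [cf _] [cg _] x.
  by apply: cvgD; [exact: cf|exact: cg].
apply: (@Ck_withinI k _ (fun x => derive_within A f x + derive_within A g x)).
- move=> x; apply: cvgD;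
  [exact: (Ck_within_continuous kf)|exact: (Ck_within_continuous kg)].
- move=> x Ax; apply: is_derive_withinD;
  [exact: (Ck_within_is_derive kf)|exact: (Ck_within_is_derive kg)].
- move=> h eh; apply: eq_Ck_within eh _.
  by apply: IH; [case: kf => _ []|case: kg => _ []].
Qed.

Lemma Ck_withinM k f g : Ck_within k f -> Ck_within k g ->
  Ck_within k (fun x => f x * g x).
Proof.
elim: k f g => [|k IH] f g kf kg.
  split=> //; case: kf kg => [cf _] [cg _] x.
  by apply: cvgM; [exact: cf|exact: cg].
apply: (@Ck_withinI k _
  (fun x => derive_within A f x * g x + f x * derive_within A g x)).
- move=> x; apply: cvgM;
  [exact: (Ck_within_continuous kf)|exact: (Ck_within_continuous kg)].
- move=> x Ax; apply: is_derive_withinM;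
  [exact: (Ck_within_is_derive kf)|exact: (Ck_within_is_derive kg)].
- move=> h eh; apply: eq_Ck_within eh _.
  apply: Ck_withinD; apply: IH; try exact: Ck_withinS.
    by case: kf => _ [].
  by case: kg => _ [].
Qed.

Lemma Ck_withinV k f : (forall x, A x -> f x != 0) -> Ck_within k f ->
  Ck_within k (fun x => (f x)^-1).
Proof.
move=> f0.
have cV : {within A, continuous f} ->
    {within A, continuous (fun x => (f x)^-1)}.
  move=> /subspace_continuousP cf; apply/subspace_continuousP => x Ax.
  by apply: cvgV; [exact: f0|exact: cf].
elim: k => [|k IH] kf; first by split=> //; apply: cV; case: kf.
apply: (@Ck_withinI k _ (fun x => - derive_within A f x / f x ^+ 2)).
- by apply: cV; case: kf.
- move=> x Ax; apply: is_derive_withinV;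
  [exact: f0|exact: (Ck_within_is_derive kf)].
- move=> h eh; have kV := IH (Ck_withinS kf).
  have kf' : Ck_within k (derive_within A f) by case: kf => _ [].
  apply: (eq_Ck_within _ (Ck_withinM (Ck_withinM (Ck_within_cst k (-1)) kf')
    (Ck_withinM kV kV))) => x xA.
  by rewrite -eh// mulN1r -invfM expr2.
Qed.

End Ck_within.

Section unit_interval.
Context {R : realType}.

Lemma unit_itv_proper (x : R) : [set` `[0 : R, 1]] x ->
  ProperFilter (within [set` `[0 : R, 1]] x^').
Proof.
rewrite /= in_itv /= => x01.
have [x0|x0] := eqVneq x 0.
  apply: (@within_dnbhs_proper _ _ _ 1); rewrite ?x0 ?(eq_sym 0) ?oner_neq0//=;
  [exact: interval_is_interval|rewrite in_itv /=; lra..].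
apply: (@within_dnbhs_proper _ _ _ 0) => //=;
  [exact: interval_is_interval|rewrite in_itv /=; lra..].
Qed.

Lemma time_itv_proper (T x : R) : [set` `[0, T[] x ->
  ProperFilter (within [set` `[0, T[] x^').
Proof.
rewrite /= in_itv /= => xT.
apply: (@within_dnbhs_proper _ _ _ ((x + T) / 2)) => /=;
  [exact: interval_is_interval|rewrite in_itv /=; lra..|].
by rewrite lt_eqF//; lra.
Qed.

End unit_interval.


(** * Consequences of the mean value theorem and of the fundamental theorem *)

Lemma is_derive0_segment_cst (R : realType) (f : R -> R) (a b : R) : a <= b ->
  {within `[a, b], continuous f} ->
  (forall x, a < x < b -> is_derive x 1 f 0) -> f b = f a.
Proof.
rewrite le_eqVlt => /predU1P[->//|ab] cf df.
have df' x : x \in `]a, b[%R -> is_derive x 1 f 0.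
  by rewrite in_itv /=; exact: df.
have [c _ /eqP] := MVT ab df' cf.
by rewrite mul0r subr_eq0 => /eqP.
Qed.

Lemma Rintegral_continuous_FTC2 (R : realType) (f F : R -> R) (a b : R) : a < b ->
  {within `[a, b], continuous f} -> {within `[a, b], continuous F} ->
  (forall x, a < x < b -> is_derive x 1 F (f x)) ->
  \int[lebesgue_measure]_(x in `[a, b]) f x = F b - F a.
Proof.
move=> ab cf cF dF; rewrite /Rintegral (@continuous_FTC2 R f F)//.
- have /continuous_within_itvP[//|_ Fa Fb] := cF.
  by split=> // x; rewrite in_itv /= => /dF [].
- by move=> x; rewrite in_itv /= => /dF h; rewrite derive1E derive_val.
Qed.

Section mixed_derivatives.
Context {R : realType}.
Implicit Types (f : R -> R -> R) (a t d : R).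

(** The mean value theorem in each variable in turn.  The left-hand side is
    symmetric in the two variables, which is what equates the two mixed
    derivatives. *)
Lemma mixed_difference (f fa fat : R -> R -> R) a t d : 0 < d ->
  (forall x y, a <= x <= a + d -> t <= y <= t + d ->
    is_derive x 1 (f ^~ y) (fa x y) /\ is_derive y 1 (fa x) (fat x y)) ->
  exists x y, [/\ a <= x <= a + d, t <= y <= t + d &
    f (a + d) (t + d) - f (a + d) t - (f a (t + d) - f a t) =
    fat x y * d * d].
Proof.
move=> d0 df.
have tt : t <= t <= t + d by lra.
have td : t <= t + d <= t + d by lra.
pose phi x := f x (t + d) - f x t.
have dphi x : x \in `[a, a + d]%R -> is_derive x 1 phi (fa x (t + d) - fa x t).
  rewrite in_itv /= => xa.
  by apply: is_deriveB; [exact: (df x _ xa td).1|exact: (df x _ xa tt).1].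
have cphi : {within `[a, a + d], continuous phi}.
  apply: derivable_within_continuous => x xa.
  by have [] := dphi x xa.
have aad : a < a + d by rewrite ltrDl.
have [x xad ephi] := MVT aad
  (fun x xa => dphi x (subset_itv_oo_cc xa)) cphi.
have {}xad : a <= x <= a + d by move: xad; rewrite in_itv /=; lra.
have ttd : t < t + d by rewrite ltrDl.
have dfa y : y \in `[t, t + d]%R -> is_derive y 1 (fa x) (fat x y).
  by rewrite in_itv /= => ytd; exact: (df x y xad ytd).2.
have cfa : {within `[t, t + d], continuous (fa x)}.
  by apply: derivable_within_continuous => y /dfa [].
have [y ytd efa] := MVT ttd
  (fun y ya => dfa y (subset_itv_oo_cc ya)) cfa.
exists x, y; split=> //; first by move: ytd; rewrite in_itv /=; lra.
have -> : f (a + d) (t + d) - f (a + d) t - (f a (t + d) - f a t) =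
  phi (a + d) - phi a by [].
by rewrite ephi efa; ring.
Qed.

Lemma near_square a t (P : set (R * R)) : nbhs (a, t) P ->
  exists2 d, 0 < d &
    forall x y, a <= x <= a + d -> t <= y <= t + d -> P (x, y).
Proof.
move=> /nbhs_ballP[e /= e0 eP].
exists (e / 2); first by rewrite divr_gt0.
move=> x y xa yt; apply: eP; split; rewrite /ball /= distrC ger0_norm; lra.
Qed.

(** Schwarz's theorem: on arbitrarily small squares the same second difference
    is a value of either mixed derivative, and both are continuous. *)
Lemma mixed_derivatives_eq (f fa ft fat fta : R -> R -> R) a t :
  (\forall x \near a & s \near t, is_derive (x : R) 1 (f ^~ s) (fa x s)) ->
  (\forall x \near a & s \near t, is_derive (s : R) 1 (f x) (ft x s)) ->
  (\forall x \near a & s \near t, is_derive (s : R) 1 (fa x) (fat x s)) ->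
  (\forall x \near a & s \near t, is_derive (x : R) 1 (ft ^~ s) (fta x s)) ->
  fat p.1 p.2 @[p --> (a, t)] --> fat a t ->
  fta p.1 p.2 @[p --> (a, t)] --> fta a t ->
  fat a t = fta a t.
Proof.
move=> dfa dft dfat dfta cfat cfta.
apply/eqP; rewrite -subr_eq0 -normr_le0; apply/ler_addgt0Pl => e e0.
have e20 : 0 < e / 2 by rewrite divr_gt0.
move/cvgrPdist_lt: cfat => /(_ _ e20) cfat.
move/cvgrPdist_lt: cfta => /(_ _ e20) cfta.
have [d d0 H] := near_square (filterI (filterI (filterI dfa dfat)
  (filterI dft dfta)) (filterI cfat cfta)).
have [x [y [xa yt E1]]] := @mixed_difference f fa fat a t d d0
  (fun x y xa yt => (H x y xa yt).1.1).
have [y' [x' [y't x'a E2]]] := @mixed_difference (fun s b => f b s)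
  (fun s b => ft b s) (fun s b => fta b s) t a d d0
  (fun y x yt xa => (H x y xa yt).1.2).
have E : fat x y = fta x' y'.
  have dn0 : d != 0 by rewrite gt_eqF.
  apply: (mulIf dn0); apply: (mulIf dn0).
  by rewrite -E1 -E2; ring.
have [_ [+ _]] := H x y xa yt.
have [_ [_ +]] := H x' y' x'a y't.
rewrite /= -E addr0 => h1 h2.
have -> : fat a t - fta a t = (fat a t - fat x y) - (fta a t - fat x y) by ring.
apply: (le_trans (ler_normB _ _)); lra.
Qed.

End mixed_derivatives.

(** * Functions of (alpha, t) *)

Section space_time.
Context {R : realType}.
Variable T : R.
Implicit Types (f g : R -> R -> R) (a t : R).

Lemma space_timeE a t : space_time T (a, t) <-> 0 <= a <= 1 /\ 0 <= t < T.
Proof. by rewrite /space_time /= !in_itv. Qed.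

Lemma continuous_stP f : continuous_st T f <->
  forall a t, space_time T (a, t) ->
    f p.1 p.2 @[p --> within (space_time T) (nbhs (a, t))] --> f a t.
Proof.
split; first by move=> /subspace_continuousP cf a t /cf.
by move=> cf; apply/subspace_continuousP => -[a t] /cf.
Qed.

Lemma continuous_stD f g : continuous_st T f -> continuous_st T g ->
  continuous_st T (fun a t => f a t + g a t).
Proof. by move=> cf cg p; apply: cvgD; [exact: cf|exact: cg]. Qed.

Lemma continuous_stM f g : continuous_st T f -> continuous_st T g ->
  continuous_st T (fun a t => f a t * g a t).
Proof. by move=> cf cg p; apply: cvgM; [exact: cf|exact: cg]. Qed.

Lemma continuous_st_alpha f t : 0 <= t < T -> continuous_st T f ->
  {within `[0, 1], continuous (f ^~ t)}.
Proof.
move=> tT /continuous_stP cf; apply/subspace_continuousP => a a01.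
have ast : space_time T (a, t) by split => //=; rewrite in_itv.
move=> P /(cf _ _ ast); rewrite /nbhs /= /within /= => -[[U V] /= [Ua Vt] UVP].
rewrite /fmap /=; apply: filterS Ua => x Ux x01.
apply: (UVP (x, t)); first by split=> //; exact: nbhs_singleton.
by split=> //=; rewrite in_itv.
Qed.

Lemma continuous_st_time f a : 0 <= a <= 1 -> continuous_st T f ->
  {within `[0, T[, continuous (f a)}.
Proof.
move=> aI /continuous_stP cf; apply/subspace_continuousP => t t0T.
have ast : space_time T (a, t) by split => //=; rewrite in_itv.
move=> P /(cf _ _ ast); rewrite /nbhs /= /within /= => -[[U V] /= [Ua Vt] UVP].
rewrite /fmap /=; apply: filterS Vt => x Vx x01.
apply: (UVP (a, x)); first by split=> //; exact: nbhs_singleton.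
by split=> //=; rewrite in_itv.
Qed.

Lemma nbhs_space_time a t : 0 < a < 1 -> 0 < t < T ->
  nbhs (a, t) (space_time T).
Proof.
move=> a01 t0T; exists (`]0, 1[%classic, `]0, T[%classic) => /=.
  by split; apply: near_in_itvoo; rewrite in_itv.
move=> [x s] /= [xI sI].
by split; apply: subset_itvW xI || apply: subset_itvW sI.
Qed.

Lemma continuous_st_interior f a t : 0 < a < 1 -> 0 < t < T ->
  continuous_st T f -> f p.1 p.2 @[p --> (a, t)] --> f a t.
Proof.
move=> a01 t0T /continuous_stP cf.
have ast := nbhs_space_time a01 t0T.
have := cf a t (nbhs_singleton ast).
apply: cvg_trans; apply: cvg_app => P Pw.
have : nbhs (a, t) (fun p => space_time T p -> P p) by exact: Pw.
by move=> h; change (nbhs (a, t) P); apply: filterS2 ast h => p stp; exact.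
Qed.

(** Supplies the dominating constants for the passages to the limit under the
    integral sign; d < T keeps the rectangle compact inside the domain. *)
Lemma continuous_st_bounded f d : d < T -> continuous_st T f ->
  exists M, forall a t, 0 <= a <= 1 -> 0 <= t <= d -> `|f a t| <= M.
Proof.
move=> dT cf.
have cK : compact (`[0, 1]%classic `*` `[0, d]%classic : set (R * R)).
  by apply: compact_setX; exact: segment_compact.
have KT : `[0, 1]%classic `*` `[0, d]%classic `<=` space_time T.
  move=> [a t] /= [aI]; rewrite in_itv /= => tI; split=> //=.
  rewrite in_itv /=; lra.
have := compact_bounded (continuous_compact (continuous_subspaceW KT cf) cK).
move=> [M [_ HM]]; exists (M + 1) => a t a01 td.
apply: (HM (M + 1)); first by rewrite ltrDl.
by exists (a, t) => //=; split; rewrite /= in_itv.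
Qed.

Lemma Ck_st_continuous k f : Ck_st T k f -> continuous_st T f.
Proof. by case: k => [|k] []. Qed.

Lemma Ck_st_alpha k f : Ck_st T k.+1 f -> Ck_st T k (d_alpha f).
Proof. by case=> _ []. Qed.

Lemma Ck_st_t k f : Ck_st T k.+1 f -> Ck_st T k (d_t T f).
Proof. by case=> _ []. Qed.

Lemma Ck_st_within k f t : 0 <= t < T -> Ck_st T k f ->
  Ck_within [set` `[0, 1]] k (f ^~ t).
Proof.
move=> tT; elim: k f => [|k IH] f [cf kf].
  by split=> //; exact: continuous_st_alpha.
split; first exact: continuous_st_alpha.
case: kf => df _ kf _; split; last exact: (IH _ kf).
by move=> a a01; apply: df; split=> //=; rewrite in_itv.
Qed.

Lemma d_alpha_is_derive k f a t : 0 < a < 1 -> 0 <= t < T ->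
  Ck_st T k.+1 f -> is_derive a 1 (f ^~ t) (d_alpha f a t).
Proof.
move=> a01 tT [_ [df _ _ _]]; apply: (@is_derive_within_interior _ [set` `[0, 1]]).
  apply: filterS (near_in_itvoo (_ : a \in `]0, 1[%R)); last by rewrite in_itv.
  by move=> x; exact: subset_itvW.
by apply: derive_withinP; apply: df; apply/space_timeE; split=> //; lra.
Qed.

Lemma d_t_is_derive k f a t : 0 <= a <= 1 -> 0 < t < T ->
  Ck_st T k.+1 f -> is_derive t 1 (f a) (d_t T f a t).
Proof.
move=> a01 tT [_ [_ df _ _]]; apply: (@is_derive_within_interior _ [set` `[0, T[]).
  apply: filterS (near_in_itvoo (_ : t \in `]0, T[%R)); last by rewrite in_itv.
  by move=> x; exact: subset_itvW.
by apply: derive_withinP; apply: df; apply/space_timeE; split=> //; lra.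
Qed.

Lemma d_alpha_d_tC f a t : 0 < a < 1 -> 0 < t < T -> Ck_st T 2 f ->
  d_t T (d_alpha f) a t = d_alpha (d_t T f) a t.
Proof.
move=> a01 t0T kf.
have near2 (P : R -> R -> Prop) : (forall x s, 0 < x < 1 -> 0 < s < T -> P x s) ->
    \forall x \near a & s \near t, P x s.
  move=> HP; exists (`]0, 1[%classic, `]0, T[%classic) => /=.
    by split; apply: near_in_itvoo; rewrite in_itv.
  by move=> [x s] /= [xI sI]; apply: HP; [move: xI|move: sI]; rewrite in_itv.
have kfa := Ck_st_alpha kf.
have kft := Ck_st_t kf.
apply: (@mixed_derivatives_eq _ f (d_alpha f) (d_t T f)
  (d_t T (d_alpha f)) (d_alpha (d_t T f))).
- by apply: near2 => x s x01 s0T; apply: (d_alpha_is_derive x01 _ kf); lra.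
- by apply: near2 => x s x01 s0T; apply: (d_t_is_derive _ s0T kf); lra.
- by apply: near2 => x s x01 s0T; apply: (d_t_is_derive _ s0T kfa); lra.
- by apply: near2 => x s x01 s0T; apply: (d_alpha_is_derive x01 _ kft); lra.
- exact: continuous_st_interior (Ck_st_continuous (Ck_st_t kfa)).
- exact: continuous_st_interior (Ck_st_continuous (Ck_st_alpha kft)).
Qed.

End space_time.

(** * Integrals depending on time *)

Section integrals.
Context {R : realType}.
Variable T : R.
Implicit Types (f g : R -> R -> R) (a t : R).
Let mu := @lebesgue_measure R.

Lemma continuous_st_integrable f t : 0 <= t < T -> continuous_st T f ->
  mu.-integrable `[0, 1] (EFin \o f ^~ t).
Proof.
move=> tT cf; apply: continuous_compact_integrable.
  exact: segment_compact.
exact: continuous_st_alpha tT cf.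
Qed.

Lemma cst01_integrable (M : R) : mu.-integrable `[0, 1] (EFin \o cst M).
Proof.
apply: continuous_compact_integrable; first exact: segment_compact.
by apply: continuous_subspaceT => x; exact: cvg_cst.
Qed.

(** The derivative in t is dominated by a constant on ]0, d[ for any d in ]t, T[,
    by compactness of [0, 1] x [0, d]. *)
Lemma is_derive_integral01 f ft t : 0 < t < T ->
  continuous_st T f -> continuous_st T ft ->
  (forall a s, 0 <= a <= 1 -> 0 < s < T -> is_derive s 1 (f a) (ft a s)) ->
  is_derive t 1 (fun s => \int[mu]_(a in `[0, 1]) f a s)
    (\int[mu]_(a in `[0, 1]) ft a t).
Proof.
move=> t0T cf cft df.
pose d := (t + T) / 2.
have dT : d < T by rewrite /d; lra.
have td : t < d by rewrite /d; lra.
have [M HM] := continuous_st_bounded dT cft.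
have Id s : `]0, d[%classic s -> 0 < s < T by rewrite /= in_itv /=; lra.
have dE s a : `]0, d[%classic s -> `[0, 1]%classic a ->
    partial1of2 (fun s a => f a s) s a = ft a s.
  move=> sI; rewrite /= in_itv /= => aI.
  have dfs := df a s aI (Id s sI).
  by rewrite /partial1of2 derive1E derive_val.
have It : `]0, d[%classic t by rewrite /= in_itv /=; lra.
have intf s : `]0, d[%classic s ->
    mu.-integrable `[0, 1] (EFin \o (fun s a => f a s) s).
  by move=> /Id sT; apply: continuous_st_integrable => //; lra.
have derf s a : `]0, d[%classic s -> `[0, 1]%classic a -> derivable (f a) s 1.
  by move=> /Id sT; rewrite /= in_itv /= => aI; have [] := df a s aI sT.
have M0 : 0 <= M.
  by apply: le_trans (HM 0 0 _ _) => //; lra.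
have ub s a : `]0, d[%classic s -> `[0, 1]%classic a ->
    `|partial1of2 (fun s a => f a s) s a| <= M.
  move=> sI aI; rewrite dE//; apply: HM; move: sI aI; rewrite /= !in_itv /=; lra.
have m01 : measurable (`[0, 1]%classic : set R) by exact: measurable_itv.
have -> : \int[mu]_(a in `[0, 1]) ft a t =
    \int[mu]_(a in `[0, 1]) partial1of2 (fun s a => f a s) t a.
  by apply: eq_Rintegral => a /set_mem aI; rewrite dE.
have c := @cvg_differentiation_under_integral R _ _ mu (fun s a => f a s)
  _ m01 t 0 d It intf derf (cst M) (fun=> M0) (cst01_integrable M) ub.
have c' : h^-1 *: ((fun s => \int[mu]_(a in `[0, 1]) f a s) (h *: 1 + t) -
    (fun s => \int[mu]_(a in `[0, 1]) f a s) t) @[h --> 0^'] -->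
    \int[mu]_(a in `[0, 1]) partial1of2 (fun s a => f a s) t a.
  by under eq_fun do rewrite scaler1.
by apply: DeriveDef; [apply/cvg_ex; eexists; exact: c'|exact: cvg_lim].
Qed.

Lemma cvg_norm_within (s : R) : `|s| < T ->
  `|u : R| @[u --> s] --> within `[0, T[%classic (nbhs `|s|).
Proof.
move=> sT P HP.
have cN : `|u : R| @[u --> s] --> `|s| by apply: cvg_norm; exact: cvg_id.
have {}HP : \forall u \near s, `[0, T[%classic `|u| -> P `|u|.
  exact: cN [set v | `[0, T[%classic v -> P v] HP.
change (\forall u \near s, P `|u|).
near=> u.
have h : `[0, T[%classic `|u| -> P `|u| by near: u.
apply: h; rewrite /= in_itv /= normr_ge0 /=.
by near: u; exact: (cvgr_lt _ cN).
Unshelve. all: by end_near. Qed.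

(** Continuity has to reach t = 0, where f is known only on one side: the even
    extension in t reduces it to continuity under the integral sign on an open
    interval around [0, d]. *)
Lemma continuous_integral01 f d : d < T -> continuous_st T f ->
  {within `[0, d], continuous (fun s => \int[mu]_(a in `[0, 1]) f a s)}.
Proof.
move=> dT cf.
have [d0|d0] := ltP d 0.
  by rewrite set_itv_ge ?bnd_simp -?ltNge//; exact: continuous_subspace0.
pose e := (d + T) / 2.
have eT : e < T by rewrite /e; lra.
have de : d < e by rewrite /e; lra.
have [M HM] := continuous_st_bounded eT cf.
pose g (s a : R) := f a `|s|.
pose I : set R := `](- e), e[%classic.
have Ie s : I s -> 0 <= `|s| < e.
  by rewrite /I /= in_itv /= -ltr_norml normr_ge0 => ->.
have m01 : measurable (`[0, 1]%classic : set R) by exact: measurable_itv.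
have intg s : I s -> mu.-integrable `[0, 1] (EFin \o g s).
  by move=> /Ie sI; apply: continuous_st_integrable => //; lra.
have cg a : `[0, 1]%classic a -> {in I, continuous (g ^~ a)}.
  rewrite /= in_itv /= => aI s /set_mem /Ie sI.
  have /subspace_continuousP cfa := continuous_st_time aI cf.
  have mT : `[0, T[%classic `|s| by rewrite /= in_itv /=; lra.
  have cm : `|u| @[u --> s] --> within `[0, T[%classic (nbhs `|s|).
    by apply: cvg_norm_within; lra.
  exact: cvg_comp cm (cfa _ mT).
have acg : {ae mu, forall a, `[0, 1]%classic a -> {in I, continuous (g ^~ a)}}.
  exact: aeW.
have ub s : I s -> {ae mu, forall a, `[0, 1]%classic a -> `|g s a| <= cst M a}.
  move=> /Ie sI; apply: aeW => a; rewrite /= in_itv /= => aI.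
  by apply: HM => //; lra.
have c := @continuity_under_integral R _ _ mu g _ m01 (- e) e intg acg
  (cst M) (cst01_integrable M) ub.
apply: (@eq_within_continuous _ _ (fun s => \int[mu]_(a in `[0, 1]) g s a)).
  move=> s /set_mem; rewrite /= in_itv /= => /andP[s0 _].
  by apply: eq_Rintegral => a _; rewrite /g ger0_norm.
apply: continuous_in_subspaceT => s /set_mem; rewrite /= in_itv /= => sI.
by apply: c; rewrite inE /I /= in_itv /=; lra.
Qed.

End integrals.

(** * Speed and mean curvature at a fixed time *)

Section curve.
Context {R : realType}.
Variables (T t : R) (r z : R -> R -> R).
Hypothesis (tT : 0 < t < T).
Hypothesis (smooth_r : smooth_st T r) (smooth_z : smooth_st T z).
Hypothesis r_neq0 : forall a, 0 <= a <= 1 -> r a t != 0.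
Hypothesis parametrization : forall a, 0 <= a <= 1 ->
  d_alpha r a t * d_alpha (d_alpha r) a t
  + d_alpha z a t * d_alpha (d_alpha z) a t = 0.

Let tT' : 0 <= t < T. Proof. by move: tT; lra. Qed.

Local Notation I01 := [set` `[0 : R, 1]].
Local Notation H := (mean_curvature r z).

Lemma smooth_st_alpha f : smooth_st T f -> smooth_st T (d_alpha f).
Proof. by move=> sf k; apply: Ck_st_alpha; exact: sf. Qed.

Lemma smooth_st_t f : smooth_st T f -> smooth_st T (d_t T f).
Proof. by move=> sf k; apply: Ck_st_t; exact: sf. Qed.

Lemma smooth_st_continuous f : smooth_st T f -> continuous_st T f.
Proof. by move=> sf; exact: Ck_st_continuous (sf 0%N). Qed.

(** The derivative of speed2 in a is twice the left-hand side of the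
    parametrization condition. *)
Lemma speed2_cst a : 0 <= a <= 1 -> speed2 r z a t = speed2 r z 0 t.
Proof.
move=> /andP[a0 a1].
have sra := smooth_st_alpha smooth_r; have sza := smooth_st_alpha smooth_z.
apply: (@is_derive0_segment_cst _ (speed2 r z ^~ t)) => //.
  have K01 : `[0, a]%classic `<=` `[0, 1]%classic.
    by move=> x /=; rewrite !in_itv /=; lra.
  apply: (continuous_subspaceW K01).
  have cc f : smooth_st T f ->
      {within `[0, 1], continuous (fun a => f a t ^+ 2)}.
    move=> sf; have cf := continuous_st_alpha tT' (smooth_st_continuous sf).
    by move=> x; apply: cvgM; exact: cf.
  by move=> x; apply: cvgD; exact: cc.
move=> x xa; have x01 : 0 < x < 1 by lra.
have dra : is_derive x 1 (d_alpha r ^~ t) (d_alpha (d_alpha r) x t).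
  exact: d_alpha_is_derive x01 tT' (sra 1%N).
have dza : is_derive x 1 (d_alpha z ^~ t) (d_alpha (d_alpha z) x t).
  exact: d_alpha_is_derive x01 tT' (sza 1%N).
have x01' : 0 <= x <= 1 by lra.
apply: (@is_derive_eq _ _ _ _ _ _ _ _
  (is_deriveD (is_deriveM dra dra) (is_deriveM dza dza))).
have e := parametrization x01'.
rewrite /GRing.scale /=.
move: (d_alpha (d_alpha r) x t) (d_alpha (d_alpha z) x t) (d_alpha r x t)
  (d_alpha z x t) e => raa zaa ra za e.
transitivity (2 * (ra * raa + za * zaa)); first by ring.
by rewrite e mulr0.
Qed.

(** On [0, 1] the powers and roots in the definition of H involve only the speed,
    which is constant; so H is a polynomial in the inverse of r and the
    derivatives of r and z, with constant coefficients. *)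
Lemma mean_curvature_Ck k : Ck_within I01 k (H ^~ t).
Proof.
pose s2 := speed2 r z 0 t.
have Cd f : smooth_st T f -> Ck_within I01 k (f ^~ t).
  by move=> sf; exact: Ck_st_within tT' (sf k).
have sra := smooth_st_alpha smooth_r; have sza := smooth_st_alpha smooth_z.
have Cra := Cd _ sra; have Cza := Cd _ sza.
have Craa := Cd _ (smooth_st_alpha sra).
have Czaa := Cd _ (smooth_st_alpha sza).
have lim := @unit_itv_proper R.
have CrV : Ck_within I01 k (fun a => (r a t)^-1).
  apply: (Ck_withinV lim _ (Cd _ smooth_r)) => a.
  by rewrite /= in_itv; exact: r_neq0.
have Cc c : Ck_within I01 k (fun=> c) := Ck_within_cst lim k c.
have CM f g := @Ck_withinM _ _ lim k f g.
have CD f g := @Ck_withinD _ _ lim k f g.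
apply: (eq_Ck_within lim _ (CD _ _
  (CM _ _ (CD _ _ (CM _ _ Cra Czaa) (CM _ _ (Cc (-1)) (CM _ _ Cza Craa)))
    (Cc (2 * s2 `^ (3 / 2))^-1))
  (CM _ _ Cza (CM _ _ CrV (Cc (2 * Num.sqrt s2)^-1))))).
move=> a /set_mem; rewrite /= in_itv /= => a01.
rewrite /mean_curvature /speed speed2_cst// mulN1r -/s2; congr (_ + _).
by rewrite -invfM mulrCA mulrA.
Qed.

End curve.

(** * Volume flux along one exterior surface *)

Section flux.
Context {R : realType}.
Variables (B T : R) (r z : R -> R -> R).
Implicit Types (a t : R).
Hypothesis (smooth_r : smooth_st T r) (smooth_z : smooth_st T z).
Hypothesis r_neq0 : forall a t : R, 0 <= a <= 1 -> 0 <= t < T -> r a t != 0.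
Hypothesis parametrization : forall a t : R, 0 <= a <= 1 -> 0 <= t < T ->
  d_alpha r a t * d_alpha (d_alpha r) a t
  + d_alpha z a t * d_alpha (d_alpha z) a t = 0.
Hypothesis motion : forall a t : R, 0 < a < 1 -> 0 < t < T ->
  surface_diffusion r z B T a t.

Local Notation I01 := [set` `[0 : R, 1]].
Local Notation H := (mean_curvature r z).

Definition volume_density (a t : R) : R := z a t * r a t * d_alpha r a t.

Definition volume_density_t (a t : R) : R :=
  (d_t T z a t * r a t + z a t * d_t T r a t) * d_alpha r a t
  + z a t * r a t * d_t T (d_alpha r) a t.

(** The second term is B times r H_a / speed, the flux of the surface diffusion;
    the first accounts for the radial motion of the endpoint. *)
Definition volume_flux (a t : R) : R :=
  z a t * r a t * d_t T r a t - B * (r a t * (d_alpha H a t / speed r z a t)).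

Lemma volume_density_continuous : continuous_st T volume_density.
Proof.
have cr := smooth_st_continuous smooth_r.
have cz := smooth_st_continuous smooth_z.
have cra := smooth_st_continuous (smooth_st_alpha smooth_r).
by do 2 apply: continuous_stM => //.
Qed.

Lemma volume_density_t_continuous : continuous_st T volume_density_t.
Proof.
have cr := smooth_st_continuous smooth_r.
have cz := smooth_st_continuous smooth_z.
have cra := smooth_st_continuous (smooth_st_alpha smooth_r).
have crt := smooth_st_continuous (smooth_st_t smooth_r).
have czt := smooth_st_continuous (smooth_st_t smooth_z).
have crat := smooth_st_continuous (smooth_st_t (smooth_st_alpha smooth_r)).
apply: continuous_stD; apply: continuous_stM => //; last exact: continuous_stM.
by apply: continuous_stD; exact: continuous_stM.
Qed.

Lemma volume_density_is_derive a t : 0 <= a <= 1 -> 0 < t < T ->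
  is_derive t 1 (volume_density a) (volume_density_t a t).
Proof.
move=> a01 tT.
have dz := d_t_is_derive a01 tT (smooth_z 1).
have dr := d_t_is_derive a01 tT (smooth_r 1).
have dra := d_t_is_derive a01 tT (smooth_st_alpha smooth_r 1).
apply: (@is_derive_eq _ _ _ _ _ _ _ _ (is_deriveM (is_deriveM dz dr) dra)).
rewrite /volume_density_t -[(z a * r a) t]/(z a t * r a t) /GRing.scale /=.
move: (d_t T z a t) (d_t T r a t) (d_t T (d_alpha r) a t) (d_alpha r a t) => *.
by ring.
Qed.

(** The volume law of one surface: by Schwarz's theorem, the equation of motion
    and the constancy of the speed, [volume_density_t] is the derivative in a of
    [volume_flux], and the latter is continuous up to the endpoints. *)
Lemma volume_density_t_integral t : 0 < t < T ->
  \int[lebesgue_measure]_(a in `[0, 1]) volume_density_t a t =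
  volume_flux 1 t - volume_flux 0 t.
Proof.
move=> tT; have tT' : 0 <= t < T by move: tT; lra.
have lim := @unit_itv_proper R.
have par a : 0 <= a <= 1 -> _ := fun a01 => parametrization a01 tT'.
have rn0 a : 0 <= a <= 1 -> _ := fun a01 => r_neq0 a01 tT'.
pose s := speed r z 0 t.
have speedE a : 0 <= a <= 1 -> speed r z a t = s.
  by move=> a01; rewrite /s /speed (speed2_cst tT).
pose Q a := r a t * d_alpha H a t.
have CH := mean_curvature_Ck tT smooth_r smooth_z rn0 par 2.
have CQ : Ck_within I01 1 Q.
  apply: Ck_withinM => //; first exact: Ck_st_within tT' (smooth_r 1).
  by case: CH => _ [].
(* The flux with the constant speed taken at a = 0, so that it is not
   differentiated. *)
pose Phi a := z a t * r a t * d_t T r a t - B / s * Q a.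
have PhiE a : 0 <= a <= 1 -> volume_flux a t = Phi a.
  by move=> a01; rewrite /volume_flux /Phi /Q speedE//; ring.
have I0 : 0 <= (0 : R) <= 1 by apply/andP; split; [exact: lexx|exact: ler01].
have I1 : 0 <= (1 : R) <= 1 by apply/andP; split; [exact: ler01|exact: lexx].
rewrite !PhiE//.
apply: (@Rintegral_continuous_FTC2 _ (volume_density_t ^~ t)) => //.
- exact: continuous_st_alpha tT' volume_density_t_continuous.
- have cz := continuous_st_alpha tT' (smooth_st_continuous smooth_z).
  have cr := continuous_st_alpha tT' (smooth_st_continuous smooth_r).
  have crt := continuous_st_alpha tT' (smooth_st_continuous (smooth_st_t smooth_r)).
  move=> x; apply: cvgB.
    by apply: cvgM; [apply: cvgM; [exact: cz|exact: cr]|exact: crt].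
  by apply: cvgM; [exact: cvg_cst|exact: (Ck_within_continuous CQ)].
move=> a a01; have a01' : 0 <= a <= 1 by move: a01; lra.
have dz := d_alpha_is_derive a01 tT' (smooth_z 1).
have dr := d_alpha_is_derive a01 tT' (smooth_r 1).
have drt := d_alpha_is_derive a01 tT' (smooth_st_t smooth_r 1).
have dQ : is_derive a 1 Q (derive_within I01 Q a).
  apply: (@is_derive_within_interior _ I01).
    apply: filterS (near_in_itvoo (_ : a \in `]0, 1[%R)); last by rewrite in_itv.
    by move=> x; exact: subset_itvW.
  by apply: (Ck_within_is_derive CQ); rewrite /= in_itv.
have dPhi := is_deriveB (is_deriveM (is_deriveM dz dr) drt)
  (is_deriveM (is_derive_cst (B / s) a 1) dQ).
apply: (@is_derive_eq _ _ _ _ _ _ _ _ dPhi).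
have dQE : d_alpha (fun a' t' => r a' t' * d_alpha H a' t') a t =
  derive_within I01 Q a by [].
have := motion a01 tT; rewrite /surface_diffusion speedE// /normal_motion dQE.
move=> mot.
have {}mot :
    r a t * (d_alpha r a t * d_t T z a t - d_alpha z a t * d_t T r a t) =
    - (B / s * derive_within I01 Q a).
  rewrite mot invfM; move: (rn0 a a01').
  move: (r a t) (s^-1) (derive_within I01 Q a) => r0 s0 q0 rn.
  by field.
rewrite /volume_density_t (d_alpha_d_tC a01 tT (smooth_r 2)) /GRing.scale /=.
rewrite -[(z^~ t * r^~ t) a]/(z a t * r a t).
rewrite mulr0 addr0 -[B / s * _]opprK -mot.
move: (d_alpha (d_t T r) a t) (d_t T r a t) (d_t T z a t) (d_alpha r a t)
  (d_alpha z a t) => *.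
by ring.
Qed.

End flux.

(** * Conservation of the total volume *)

Unset Implicit Arguments.
Set Strict Implicit.

Theorem lemma3p2 (R : realType) (A B beta theta_c T : R)
    (r z theta : curve -> R -> R -> R)
    (r1s r3s z2s rbar zbar : R -> R)
    (hA : 0 < A) (hB : 0 < B) (hbeta : pi / 2 <= beta < pi)
    (htheta_c : 0 <= theta_c <= pi) (hT : 0 < T)
    (hsol : evolution_solution A B beta theta_c T r z theta
              r1s r3s z2s rbar zbar) :
  forall s t : R, 0 <= s < T -> 0 <= t < T ->
    total_volume r z s = total_volume r z t.
Proof.
suff base t : 0 <= t < T -> total_volume r z t = total_volume r z 0.
  by move=> s t sT tT; rewrite !base.
have sr i := (sol_smooth hsol i).1; have sz i := (sol_smooth hsol i).2.
have par i (a u : R) : 0 <= a <= 1 -> 0 <= u < T -> _ :=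
  fun a01 uT => sol_parametrization hsol i ((space_timeE T a u).2 (conj a01 uT)).
have r1_neq0 (a u : R) : 0 <= a <= 1 -> 0 <= u < T -> r G1 a u != 0.
  by move=> a01 uT; have [/andP[/gt_eqF ->]] := sol_r13 hsol a01 uT.
have r2_neq0 (a u : R) : 0 <= a <= 1 -> 0 <= u < T -> r G2 a u != 0.
  move=> /andP[a0]; rewrite le_eqVlt => /predU1P[->|a1] uT.
    by have [-> _] := sol_end2_1 hsol uT; rewrite oner_neq0.
  have a01 : 0 <= a < 1 by rewrite a0.
  by have /andP[/gt_eqF ->] := sol_r2 hsol a01 uT.
pose V i (s : R) :=
  \int[lebesgue_measure]_(a in `[0, 1]) volume_density (r i) (z i) a s.
have VE s : total_volume r z s = 2 * pi * (V G1 s + V G2 s).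
  by rewrite /total_volume big_cons big_seq1.
move=> /andP[t0 tT]; rewrite !VE; congr (_ * _).
apply: (@is_derive0_segment_cst _ (fun s => V G1 s + V G2 s) 0 t t0).
  have cV i := continuous_integral01 tT (volume_density_continuous (sr i) (sz i)).
  by move=> s; apply: cvgD; exact: cV.
move=> s /andP[s0 st]; have sT : 0 < s < T by rewrite s0 (lt_trans st).
have sT' : 0 <= s < T by rewrite ltW//= (lt_trans st).
have sI : [set` `[0, T[] s by rewrite /= in_itv.
have dV i : is_derive s 1 (V i)
    (\int[lebesgue_measure]_(a in `[0, 1]) volume_density_t T (r i) (z i) a s).
  exact: (is_derive_integral01 sT (volume_density_continuous (sr i) (sz i))
    (volume_density_t_continuous (sr i) (sz i))
    (volume_density_is_derive (sr i) (sz i))).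
apply: (is_derive_eq (is_deriveD (dV G1) (dV G2))).
rewrite (volume_density_t_integral (sr G1) (sz G1) r1_neq0 (par G1)
  (sol_motion1 hsol) sT).
rewrite (volume_density_t_integral (sr G2) (sz G2) r2_neq0 (par G2)
  (sol_motion2 hsol) sT).
have limT := @time_itv_proper R T.
have I1 : 0 <= (1 : R) <= 1 by apply/andP; split; [exact: ler01|exact: lexx].
have I0 : 0 <= (0 : R) <= 1 by apply/andP; split; [exact: lexx|exact: ler01].
have drE i (a : R) : 0 <= a <= 1 ->
    is_derive_within [set` `[0, T[] (r i a) s (d_t T (r i) a s).
  move=> a01; apply: derive_withinP.
  by have [_ [_ + _ _]] := sr i 1; apply; apply/space_timeE.
have rt_junction : d_t T (r G2) 0 s = d_t T (r G1) 1 s.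
  apply: (is_derive_withinE limT sI).
  apply: (eq_is_derive_within sI _ (drE G1 1 I1)) => u.
  rewrite inE /= in_itv /= => uT.
  by have [-> _] := sol_end1_1 hsol uT; have [-> _] := sol_end2_0 hsol uT.
have rt_wall : d_t T (r G2) 1 s = 0.
  apply: (is_derive_withinE limT sI).
  apply: (eq_is_derive_within sI _ (is_derive_within_cst _ 1 s)) => u.
  rewrite inE /= in_itv /= => uT.
  by have [-> _] := sol_end2_1 hsol uT.
rewrite /volume_flux rt_junction rt_wall (sol_flux1_0 hsol sT')
  (sol_flux2_1 hsol sT').
rewrite (sol_flux12 hsol sT').
have [-> ->] := sol_end1_1 hsol sT'; have [-> ->] := sol_end2_0 hsol sT'.
have [_ ->] := sol_end1_0 hsol sT'.
by rewrite !mul0r !mulr0; ring.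
Qed.
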